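(* Let $\delta\in\{\mathsf{none},\mathsf{down},\mathsf{up},\mathsf{updown}\}^n$. If $T,T'\in\mathcal{PT}_n(\delta)$ satisfy $T<T'$ in the $\delta$-permutree rotation lattice, then $\vec{c}(T)<_{lex}\vec{c}(T')$. Moreover, every edge of the cubical realization $\mathcal{C}_\delta$ has direction $\mathbf{e}_i$ for some $i\in[n-1]$ (a standard basis vector of $\mathbb{R}^{n-1}$).
   Context: $[n]=\{1,\dots,n\}$. A permutree on $n$ vertices is a directed (unrooted, planar) tree $T$ with vertex set $\{v_1,\dots,v_n\}$, edges oriented from child to parent, such that each vertex $v_i$ has exactly one or two parents and exactly one or two children, and: if $v_i$ has two parents then every vertex $v_j$ in its left ancestor subtree has $j<i$ and every $v_k$ in its right ancestor subtree has $k>i$; if $v_i$ has two children then every $v_j$ in its left descendant subtree $LD_i$ has $j<i$ and every $v_k$ in its right descendant subtree $RD_i$ has $k>i$ (ancestor/descendant subtrees are the components of $T\setminus v_i$ containing the respective parents/children; if $v_i$ has one child, $D_i$ denotes its unique descendant subtree). The decoration $\delta(T)_i$ is $\mathsf{none}$, $\mathsf{down}$, $\mathsf{up}$, $\mathsf{updown}$ according as $v_i$ has (one parent, one child), (one parent, two children), (two parents, one child), (two parents, two children); $\mathcal{PT}_n(\delta)$ is the set of permutrees with decoration $\delta$ (convention $\delta_1=\delta_n=\mathsf{none}$). We write $i\to j$ if $v_i$ is a descendant of $v_j$. The rotation order (Pilaud–Pons) is the transitive closure of increasing edge rotations: for an edge $i\to j$ with $i<j$, the $ij$-edge rotation replaces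 it by an edge $j\to i$ (rearranging the adjacent subtrees) while preserving all other edge cuts; $T\lessdot T'$ denotes a cover relation. The cubic set of $T$ is $C(T)=\{(i,j): i<j,\ v_j\in D_i\text{ if }\delta_i\in\{\mathsf{none},\mathsf{up}\};\ v_j\in RD_i\text{ if }\delta_i\in\{\mathsf{down},\mathsf{updown}\}\}$, with components $C(T)_i=\{j:(i,j)\in C(T)\}$, and the cubic vector is $\vec{c}(T)=(c_1,\dots,c_{n-1})$ with $c_i=|C(T)_i|$. The cubical realization $\mathcal{C}_\delta$ is the convex hull of all cubic vectors $\vec{c}(T)$, $T\in\mathcal{PT}_n(\delta)$, together with an edge between $\vec{c}(T)$ and $\vec{c}(T')$ whenever $T\lessdot T'$. $<_{lex}$ is the lexicographic order. *)

(* Defs.v *)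
From HB Require Import structures.
From Stdlib Require Import Relation_Operators.
From mathcomp Require Import all_boot all_order all_algebra.
From mathcomp Require Import classical_sets reals convex.

Set Implicit Arguments.
Unset Strict Implicit.
Unset Printing Implicit Defensive.

Import Order.TTheory GRing.Theory Num.Theory.

Inductive decoration := dnone | down | up | updown.

(* A directed graph on 'I_n (vertex i is v_{i+1}) drawn in the plane: each     *)
(* vertex carries the left-to-right lists of its outgoing slots (parents) and  *)
(* incoming slots (children). An empty slot None is a dangling edge ending at  *)
(* an unlabelled leaf; it counts as a parent or child, which is what allows    *)
(* every vertex of a finite tree to have at least one of each.                 *)
Record planar_digraph (n : nat) := PlanarDigraph {
  parents : {ffun 'I_n -> seq (option 'I_n)};
  children : {ffun 'I_n -> seq (option 'I_n)}
}.

Section PlanarDigraph.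
Variables (n : nat) (G : planar_digraph n).

(* edges oriented from child i to parent j *)
Definition dedge : rel 'I_n := [rel i j | Some j \in parents G i].

Definition adj : rel 'I_n := [rel i j | dedge i j || dedge j i].

(* The component of G \ v_i hanging from a slot s of i; empty for a leaf. *)
Definition subtree (i : 'I_n) (s : option 'I_n) : {set 'I_n} :=
  if s is Some j then
    [set k | connect [rel x y | [&& adj x y, x != i & y != i]] j k]
  else finset.set0.

Record is_tree : Prop := IsTree {
  tree_connected : forall i j, connect adj i j;
  tree_acyclic : forall c : seq 'I_n, 2 < size c -> ~ ucycle adj c
}.

Record is_permutree : Prop := IsPermutree {
  pt_incidence : forall i j,
    (Some j \in parents G i) = (Some i \in children G j);
  (* for i = j this also excludes loops *)
  pt_antisym : forall i j, dedge i j -> ~~ dedge j i;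
  pt_tree : is_tree;
  pt_parents : forall i, size (parents G i) = 1 \/ size (parents G i) = 2;
  pt_children : forall i, size (children G i) = 1 \/ size (children G i) = 2;
  pt_ancestors : forall i l r, parents G i = [:: l; r] ->
    (forall j, j \in subtree i l -> j < i) /\
    (forall k, k \in subtree i r -> i < k);
  pt_descendants : forall i l r, children G i = [:: l; r] ->
    (forall j, j \in subtree i l -> j < i) /\
    (forall k, k \in subtree i r -> i < k)
}.

End PlanarDigraph.

Record permutree (n : nat) := Permutree {
  graph :> planar_digraph n;
  permutreeP : is_permutree graph
}.

Definition deco n (T : permutree n) (i : 'I_n) : decoration :=
  match size (parents T i) == 2, size (children T i) == 2 with
  | false, false => dnone
  | false, true => down
  | true, false => up
  | true, true => updown
  end.

Record PT (n : nat) (delta : {ffun 'I_n -> decoration}) := InPT {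
  tree_of :> permutree n;
  tree_ofP : forall i, deco tree_of i = delta i
}.

Section RotationOrder.
Variables (n : nat) (delta : {ffun 'I_n -> decoration}).
Implicit Types T S : PT delta.

(* The ordered pair (I, J) of components left by deleting the edge i -> j,     *)
(* with i in I and j in J.                                                     *)
Definition edge_cut T (i j : 'I_n) : {set 'I_n} * {set 'I_n} :=
  let e := [rel x y | adj T x y && ((x, y) \notin [:: (i, j); (j, i)])] in
  ([set k | connect e i k], [set k | connect e j k]).

Definition other_cuts T (i j : 'I_n) : {set {set 'I_n} * {set 'I_n}} :=
  [set edge_cut T p.1 p.2 | p in [pred p | dedge T p.1 p.2 && (p != (i, j))]].

Definition edge_rotation (i j : 'I_n) T T' : Prop :=
  [/\ dedge T i j, dedge T' j i & other_cuts T i j = other_cuts T' j i].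

Definition increasing_rotation T T' : Prop :=
  exists i j : 'I_n, i < j /\ edge_rotation i j T T'.

Definition rotation_lt : PT delta -> PT delta -> Prop :=
  clos_trans (PT delta) increasing_rotation.

Definition rotation_cover T T' : Prop :=
  rotation_lt T T' /\ ~ (exists S, rotation_lt T S /\ rotation_lt S T').

End RotationOrder.

Section CubicVector.
Variables (n : nat) (T : permutree n).

(* If v_i has one child, slot 0 is D_i; if it has two, slot 1 is RD_i. *)
Definition descendants (i : 'I_n) : {set 'I_n} :=
  subtree T i (nth None (children T i) 0).

Definition right_descendants (i : 'I_n) : {set 'I_n} :=
  subtree T i (nth None (children T i) 1).

Definition cubic_set : {set 'I_n * 'I_n} :=
  [set p : 'I_n * 'I_n | (p.1 < p.2) &&
    match deco T p.1 with
    | dnone | up => p.2 \in descendants p.1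
    | down | updown => p.2 \in right_descendants p.1
    end].

Definition cubic_component (i : 'I_n) : {set 'I_n} :=
  [set j | (i, j) \in cubic_set].

Definition cubic_vector : (n.-1).-tuplelexi nat :=
  [tuple #|cubic_component (widen_ord (leq_pred n) i)| | i < n.-1].

End CubicVector.

Local Open Scope ring_scope.
Local Open Scope classical_set_scope.

Record polytope_with_edges (R : realType) (m : nat) := PolytopeWithEdges {
  body : set 'rV[R]_m;
  edges : set ('rV[R]_m * 'rV[R]_m)
}.

Definition cubic_point (R : realType) n (T : permutree n) : 'rV[R]_(n.-1) :=
  \row_i (tnth (cubic_vector T) i)%:R.

Definition cubical_realization (R : realType) n
    (delta : {ffun 'I_n -> decoration}) : polytope_with_edges R n.-1 :=
  {| body := smallest (@convex_set R 'rV[R]_(n.-1))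
               [set x | exists T : PT delta, x = cubic_point R T];
     edges := [set e | exists T T' : PT delta, rotation_cover T T' /\
                       e = (cubic_point R T, cubic_point R T')] |}.

Definition has_direction (R : realType) m (e : 'rV[R]_m * 'rV[R]_m)
    (v : 'rV[R]_m) : Prop :=
  exists2 a : R, a != 0 & e.2 - e.1 = a *: v.

(* Main.v *)
Require Import Defs.
From mathcomp Require Import all_boot all_order all_algebra.
From mathcomp Require Import classical_sets reals.

(* Since right descendant subtrees only contain larger labels and left ones    *)
(* only smaller labels, C(T)_k is the set of l > k lying in some child subtree *)
(* of k, whatever the decoration of k. Deleting a connected set K of vertices, *)
(* the component of l is the largest side, among all edge cuts, that contains  *)
(* l and avoids K; whether it hangs below K is the orientation of that cut.    *)
(* For K = {k} with k distinct from i and j, and for K = {i, j}, this only     *)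
(* involves the cuts preserved by the rotation of i -> j into j -> i. Hence    *)
(* C(T)_k is preserved for k <> i, j. The label conditions at i and j imply    *)
(* that C(T)_j is the set of l > j hanging below {i, j} both before and after, *)
(* and that C(T)_i only grows, gaining j. So an increasing rotation increases  *)
(* the i-th coordinate and fixes all others, and a cover is one rotation.      *)

Set Implicit Arguments.
Unset Strict Implicit.
Unset Printing Implicit Defensive.

Import Order.TTheory GRing.Theory Num.Theory.

(** In terms of the lemmas: [cubic_componentP] frees C(T)_k from the decoration, and [hangs_belowP]
    recovers from the cuts whether a component hangs below K. The latter turns equality of the other
    cuts into the comparisons [cubic_component_rotation_other], [cubic_component_rotation_target]
    and [cubic_component_rotation_source]. One rotation thus raises a single coordinate, which is a
    lexicographic increase, and transitivity gives the order statement. *)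

Section Sides.
Variables (n : nat) (T : permutree n).
Implicit Types u v w x y k l c d : 'I_n.

(** * Sides of edge cuts in a tree *)

Definition adj_but u v : rel 'I_n :=
  [rel x y | adj T x y && ((x, y) \notin [:: (u, v); (v, u)])].

(** One half of [edge_cut], with the orientation of the edge forgotten: both halves get the same
    form, [side u v] and [side v u]. *)
Definition side u v : {set 'I_n} := [set x | connect (adj_but u v) u x].

Lemma adjC : symmetric (adj T).
Proof. by move=> x y; rewrite /adj /= orbC. Qed.

Lemma adj_irr : irreflexive (adj T).
Proof.
move=> x; rewrite /adj /= orbb; apply/negbTE/negP => e.
by have := pt_antisym (permutreeP T) e; rewrite e.
Qed.

Lemma dedge_adj u v : dedge T u v -> adj T u v.
Proof. by rewrite /adj /= => ->. Qed.

Lemma adj_butC u v : symmetric (adj_but u v).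
Proof.
move=> x y; rewrite /adj_but /= adjC !inE !xpair_eqE orbC.
by congr (_ && ~~ (_ || _)); apply: andbC.
Qed.

Lemma connect_butC u v : connect_sym (adj_but u v).
Proof. exact/sym_connect_sym/adj_butC. Qed.

Lemma adj_but_swap u v : adj_but u v =2 adj_but v u.
Proof. by move=> x y; rewrite /adj_but /= !inE orbC. Qed.

Lemma side_refl u v : u \in side u v.
Proof. by rewrite inE. Qed.

Lemma side_step u v x y : x \in side u v -> adj T x y ->
  (x, y) != (u, v) -> (x, y) != (v, u) -> y \in side u v.
Proof.
rewrite !inE => ux xy n1 n2; apply: connect_trans ux (connect1 _).
by rewrite /adj_but /= xy !inE negb_or n1 n2.
Qed.

(** A simple path from u to v avoiding the edge uv has at least two edges, so the edge closes it
    into a cycle of length at least 3. *)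
Lemma side_notin u v : adj T u v -> v \notin side u v.
Proof.
move=> uv; rewrite inE; apply/negP => /connectP [p0 p0P].
case/shortenP: p0P => p pP Up _ vE.
have pA : path (adj T) u p by apply: sub_path pP => x y /andP [].
case: p => [|x [|y p]] in pP Up vE pA *; first by rewrite vE adj_irr in uv.
  by move: pP; rewrite vE /= /adj_but /= !inE eqxx andbF.
apply: (tree_acyclic (pt_tree (permutreeP T)) (c := [:: u, x, y & p])) => //.
by rewrite /ucycle Up andbT [cycle _ _]rcons_path pA adjC -[last _ _]vE.
Qed.

Lemma side_disjoint u v x : adj T u v -> x \in side u v -> x \notin side v u.
Proof.
move=> uv; apply: contraL => vx; apply/negP => ux.
have /negP := side_notin uv; apply; move: ux vx; rewrite !inE => ux.
rewrite (eq_connect (adj_but_swap v u)) connect_butC.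
exact: connect_trans.
Qed.

(** A walk from l inside [side a b] never meets v, so it never uses the edge uv. This gives the
    maximality of [side u v] among sides avoiding v. *)
Lemma side_sub u v a b : [disjoint side a b & [set v]] ->
  forall l, l \in side a b -> l \in side u v -> side a b \subset side u v.
Proof.
move=> dv l la lu; apply/fintype.subsetP => x; move: la; rewrite [x \in _]inE inE => la ax.
have : connect (adj_but a b) l x by apply: connect_trans ax; rewrite connect_butC.
case/connectP => p; have {}la : l \in side a b by rewrite inE.
move=> pP ->{x ax}; elim: p l la lu pP => //= y p IH l la lu /andP [ly yp].
have ya : y \in side a b.
  by move: la; rewrite !inE => /connect_trans; apply; apply: connect1.
have ne z : z \in side a b -> z != v.
  by move=> za; apply: contraTneq za => ->; rewrite (disjointFl dv) ?set11.
case/andP: (ly) => ly' _.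
apply: (IH y) => //; apply: (side_step lu ly'); rewrite xpair_eqE negb_and.
  by rewrite (ne _ ya) orbT.
by rewrite (ne _ la).
Qed.

Lemma sub_side_next u v w : adj T u v -> adj T v w -> u != w ->
  side u v \subset side v w.
Proof.
move=> uv vw uw.
have wN : w \notin side u v.
  apply: contra (side_notin uv) => wu.
  apply: (side_step wu); rewrite 1?adjC // xpair_eqE negb_and ?(eq_sym w) ?uw //.
  by apply/orP; left; apply: contraTneq vw => ->; rewrite adj_irr.
apply: (@side_sub v w u v _ u) (side_refl _ _) _; first by rewrite disjoint_sym disjoints1.
apply: (side_step (side_refl v w)); rewrite 1?adjC // xpair_eqE negb_and ?uw ?orbT //.
by apply/orP; left; apply: contraTneq vw => ->; rewrite adj_irr.
Qed.

(** Deleting the vertex k or only the edge ck leaves c the same component, since that component does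
    not reach k in either case. *)
Lemma subtreeE k c : adj T c k -> subtree T k (Some c) = side c k.
Proof.
move=> ck; apply/setP => x; rewrite !inE; apply/idP/idP.
  apply: connect_sub => y z /and3P [yz yk zk]; apply: connect1.
  by rewrite /adj_but /= yz !inE !xpair_eqE (negbTE yk) (negbTE zk) andbF.
case/connectP => p pP ->{x}.
suff gen x : x \in side c k -> path (adj_but c k) x p ->
    connect [rel x y | [&& adj T x y, x != k & y != k]] x (last x p).
  exact: gen (side_refl c k) pP.
elim: p {pP} x => [|y p IH] x /= xc => [_|/andP [xy yp]]; first exact: connect0.
have yc : y \in side c k.
  by move: xc; rewrite !inE => /connect_trans; apply; apply: connect1.
have ne z : z \in side c k -> z != k.
  by move=> zc; apply: contraTneq zc => ->; apply: side_notin.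
apply: connect_trans (IH _ yc yp); apply: connect1.
by case/andP: xy => /= -> _; rewrite !ne.
Qed.

(** * Subtrees at a vertex, label conditions and cubic sets *)

Lemma first_entry (K : {set 'I_n}) k l : k \in K -> l \notin K ->
  exists u v, [/\ adj T u v, v \in K, u \notin K & l \in side u v].
Proof.
move=> kK lK.
have [p pP kE] := connectP (tree_connected (pt_tree (permutreeP T)) l k).
rewrite {}kE in kK.
elim: p l lK pP kK => [|y p IH] x xK /=; first by rewrite (negbTE xK).
case/andP => xy yp lastK; have [yK|yK] := boolP (y \in K).
  by exists x, y; rewrite side_refl.
have [u [v [uv vK uK yu]]] := IH _ yK yp lastK.
exists u, v; split=> //; apply: (side_step yu); rewrite 1?adjC // xpair_eqE negb_and.
  by rewrite orbC; apply/orP; left; apply: contraNneq xK => ->.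
by apply/orP; left; apply: contraNneq yK => ->.
Qed.

Lemma toward k l : l != k -> exists2 u, adj T u k & l \in side u k.
Proof.
move=> lk; have [u [v [uv /set1P vk _ lu]]] : exists u v,
    [/\ adj T u v, v \in [set k], u \notin [set k] & l \in side u v].
  by apply: (first_entry (k := k)); rewrite ?set11 ?inE.
by rewrite -vk; exists u.
Qed.

(** Only one child subtree of k can contain labels above k: if k has two children, the left subtree
    has only smaller labels. *)
Lemma two_children_sides k c d l m : dedge T c k -> dedge T d k ->
  l \in side c k -> m \in side d k -> k < l -> k < m -> c = d.
Proof.
move=> ck dk; rewrite -!subtreeE ?dedge_adj // => lc md kl km.
move: ck dk; rewrite /dedge /= !(pt_incidence (permutreeP T)).
have [] := pt_children (permutreeP T) k.
  by case: (children T k) => [|a []] //= _; rewrite !inE => /eqP <- /eqP [].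
case E: (children T k) => [|a [|b []]] //= _; rewrite !inE.
have [sa _] := pt_descendants (permutreeP T) E.
case/orP => /eqP cE; first by move: (sa l); rewrite -cE lc ltnNge (ltnW kl) => /(_ isT).
case/orP => /eqP dE; first by move: (sa m); rewrite -dE md ltnNge (ltnW km) => /(_ isT).
by move: dE; rewrite -cE => -[].
Qed.

Lemma two_parents_sides k c d l m : dedge T k c -> dedge T k d ->
  l \in side c k -> m \in side d k -> k < l -> k < m -> c = d.
Proof.
move=> kc kd; rewrite -!subtreeE 1?adjC ?dedge_adj // => lc md kl km.
move: kc kd; rewrite /dedge /=.
have [] := pt_parents (permutreeP T) k.
  by case: (parents T k) => [|a []] //= _; rewrite !inE => /eqP <- /eqP [].
case E: (parents T k) => [|a [|b []]] //= _; rewrite !inE.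
have [sa _] := pt_ancestors (permutreeP T) E.
case/orP => /eqP cE; first by move: (sa l); rewrite -cE lc ltnNge (ltnW kl) => /(_ isT).
case/orP => /eqP dE; first by move: (sa m); rewrite -dE md ltnNge (ltnW km) => /(_ isT).
by move: dE; rewrite -cE => -[].
Qed.

(** The decoration disappears because a left descendant subtree contains no l > k; an empty slot
    contributes no vertex. *)
Lemma cubic_componentP k l :
  reflect (k < l /\ exists2 c, dedge T c k & l \in side c k)
          (l \in cubic_component T k).
Proof.
rewrite !inE /=; case: (ltnP k l) => kl; last by apply: (iffP idP) => // -[].
have inc c : dedge T c k = (Some c \in children T k).
  exact: (pt_incidence (permutreeP T)).
have -> : match deco T k with
    | dnone | Defs.up => l \in descendants T k
    | Defs.down | updown => l \in right_descendants T k
    end = (l \in if size (children T k) == 2 then right_descendants T k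
                 else descendants T k).
  by rewrite /deco; case: eqP; case: eqP.
rewrite /descendants /right_descendants /=; apply: (iffP idP).
  move=> lS; split=> //; move: lS; have [] := pt_children (permutreeP T) k.
    case E: (children T k) => [|[c|] []] //= _ lS; last by rewrite finset.in_set0 in lS.
    have ck : dedge T c k by rewrite inc E inE.
    by exists c => //; rewrite -(subtreeE (dedge_adj ck)).
  case E: (children T k) => [|a [|[c|] []]] //= _ lS; last by rewrite finset.in_set0 in lS.
  have ck : dedge T c k by rewrite inc E !inE eqxx orbT.
  by exists c => //; rewrite -(subtreeE (dedge_adj ck)).
case=> _ [c ck]; rewrite -(subtreeE (dedge_adj ck)) => lc; move: ck; rewrite inc.
have [] := pt_children (permutreeP T) k.
  by case: (children T k) => [|a []] //= _; rewrite inE => /eqP <-.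
case E: (children T k) => [|a [|b []]] //= _; rewrite !inE.
have [sa _] := pt_descendants (permutreeP T) E.
case/orP => /eqP cE; last by rewrite -cE.
by have := sa l; rewrite -cE => /(_ lc); rewrite ltnNge (ltnW kl).
Qed.

End Sides.

(** * Reading descendants off the preserved cuts *)

Section Rotations.
Variables (n : nat) (delta : {ffun 'I_n -> decoration}).
Implicit Types (T : PT delta) (i j k l c u v x : 'I_n) (K : {set 'I_n}).

Lemma edge_cutE T i j : edge_cut T i j = (side T i j, side T j i).
Proof.
rewrite /edge_cut /side; congr (_, _).
by apply/setP => x; rewrite !inE; apply: eq_connect; apply: adj_but_swap.
Qed.

Lemma other_cutsP T i j A B :
  reflect (exists u v, [/\ dedge T u v, (u, v) != (i, j),
                           A = side T u v & B = side T v u])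
          ((A, B) \in other_cuts T i j).
Proof.
apply: (iffP imsetP) => [[[u v]]|[u [v [uv ne -> ->]]]].
  by rewrite inE edge_cutE /= => /andP [uv ne] [-> ->]; exists u, v.
by exists (u, v); rewrite ?edge_cutE // inE /= uv.
Qed.

(* The largest side of a cut in X that contains l and avoids K is a child side. *)
Definition maximal_down (X : {set {set 'I_n} * {set 'I_n}}) K l : Prop :=
  exists A B, [/\ (A, B) \in X, l \in A, [disjoint A & K] &
    forall C D, (C, D) \in X ->
      (l \in C -> [disjoint C & K] -> C \subset A) /\
      (l \in D -> [disjoint D & K] -> D \subset A)].

Definition hangs_below T K l : Prop :=
  exists c v, [/\ dedge T c v, v \in K, c \notin K & l \in side T c v].

(** The hypothesis on i and j keeps the edge ij off the boundary of K, so every boundary edge gives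
    a cut in [other_cuts]. The last hypothesis is the connectedness of K: it lies wholly on one side
    of each boundary edge. *)
Lemma hangs_belowP T i j K l k : k \in K -> (i \in K) = (j \in K) ->
  (forall u v x, adj T u v -> v \in K -> u \notin K -> x \in K ->
     x \in side T v u) ->
  hangs_below T K l <-> maximal_down (other_cuts T i j) K l.
Proof.
move=> kK ijK connK.
have offK u v : adj T u v -> v \in K -> u \notin K -> [disjoint side T u v & K].
  move=> uv vK uK; rewrite disjoint_sym disjoint_subset; apply/fintype.subsetP => x xK.
  by rewrite inE; apply: side_disjoint (connK _ _ _ uv vK uK xK); rewrite adjC.
have maxK u v : adj T u v -> v \in K -> u \notin K -> l \in side T u v ->
    forall a b, l \in side T a b -> [disjoint side T a b & K] ->
    side T a b \subset side T u v.
  move=> uv vK uK lu a b la dK; apply: side_sub la lu.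
  by apply: disjointWr dK; rewrite finset.sub1set.
have other u v : v \in K -> u \notin K -> (u, v) != (i, j) /\ (v, u) != (i, j).
  move=> vK uK; split; apply: contra uK => /eqP [uE vE].
    by rewrite uE ijK -vE.
  by rewrite vE -ijK -uE.
split=> [[u [v [uv vK uK lu]]]|[A [B [/other_cutsP [a [b [ab _ -> _]]] la dA maxA]]]].
  have uv' := dedge_adj uv.
  exists (side T u v), (side T v u); split=> //.
  - by apply/other_cutsP; exists u, v; split=> //; case: (other u v).
  - exact: offK.
  - move=> C D /other_cutsP [a [b [_ _ -> ->]]].
    by split=> la dK; apply: maxK.
have lK : l \notin K by rewrite (disjointFr dA la).
have [u [v [uv vK uK lu]]] := first_entry T kK lK.
case/orP: (uv) => [uv'|vu]; first by exists u, v.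
(* Suppose the boundary edge leaves K upwards, v to u. By maximality the sides of uv and ab
   coincide; but ab is a different edge, so crossing it from a stays in [side T u v], which puts b
   in [side T a b]. *)
have [sub1 sub2] : side T u v \subset side T a b /\ side T a b \subset side T u v.
  split; last exact: maxK.
  have : (side T v u, side T u v) \in other_cuts T i j.
    by apply/other_cutsP; exists v, u; split=> //; case: (other u v).
  by case/maxA => _; apply => //; apply: offK.
have ab' := dedge_adj ab.
have /negP [] := side_notin ab'; apply: (fintype.subsetP sub1).
apply: (side_step _ ab'); first exact: (fintype.subsetP sub2) (side_refl _ _ _).
  apply/eqP => -[aE bE].
  by have := pt_antisym (permutreeP T) ab; rewrite aE bE vu.
apply/eqP => -[aE bE].
have /negP [] := side_notin uv; apply: (fintype.subsetP sub2).
by rewrite -aE side_refl.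
Qed.

Lemma hangs_below1 T i j k l : k != i -> k != j ->
  hangs_below T [set k] l <-> maximal_down (other_cuts T i j) [set k] l.
Proof.
move=> ki kj; apply: (@hangs_belowP T i j [set k] l k).
- by rewrite inE.
- by rewrite !inE ![_ == k]eq_sym (negbTE ki) (negbTE kj).
- by move=> u v x _ /set1P -> _ /set1P ->; apply: side_refl.
Qed.

Lemma hangs_below2 T i j l : adj T i j ->
  hangs_below T [set i; j] l <-> maximal_down (other_cuts T i j) [set i; j] l.
Proof.
move=> ij; apply: (@hangs_belowP T i j [set i; j] l i).
- by rewrite !inE eqxx.
- by rewrite !inE !eqxx orbT.
- move=> u v x uv vK uK xK.
  have [->|xv] := eqVneq x v; first exact: side_refl.
  apply: (side_step (side_refl T v u)).
  + by move: vK xK xv; rewrite !inE => /orP [] /eqP -> /orP [] /eqP ->;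
      rewrite ?eqxx // adjC.
  + by rewrite xpair_eqE negb_and; apply/orP; right; apply: contraNneq uK => <-.
  + by rewrite xpair_eqE negb_and; apply/orP; left; apply: contraNneq uK => <-.
Qed.

Lemma child_not_parent T u v c : dedge T u v -> dedge T c u -> c != v.
Proof.
by move=> uv cu; apply: contraTneq cu => ->; apply: (pt_antisym (permutreeP T)).
Qed.

(** * Effect of one rotation on the cubic set *)

Section OneRotation.
Variables (T T' : PT delta) (i j : 'I_n).
Hypotheses (ltij : i < j) (rot : edge_rotation i j T T').

Let ij : dedge T i j. Proof. by case: rot. Qed.
Let ji : dedge T' j i. Proof. by case: rot. Qed.
Let cuts : other_cuts T i j = other_cuts T' j i. Proof. by case: rot. Qed.

Lemma rotation_hangs_below l :
  hangs_below T [set i; j] l <-> hangs_below T' [set i; j] l.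
Proof.
rewrite (hangs_below2 _ (dedge_adj ij)) cuts.
by rewrite [[set i; j]]finset.setUC (hangs_below2 _ (dedge_adj ji)).
Qed.

Lemma cubic_component_rotation_other k : k != i -> k != j ->
  cubic_component T k = cubic_component T' k.
Proof.
move=> ki kj.
have hang (S : PT delta) l :
    hangs_below S [set k] l <-> exists2 c, dedge S c k & l \in side S c k.
  split=> [[c [v [cv /set1P vk _ lc]]]|[c ck lc]].
    by rewrite -vk; exists c.
  exists c, k; split; rewrite ?set11 // inE.
  by apply: contraTneq (dedge_adj ck) => ->; rewrite adj_irr.
have eqv l : (exists2 c, dedge T c k & l \in side T c k) <->
    exists2 c, dedge T' c k & l \in side T' c k.
  by rewrite -!hang (hangs_below1 _ _ ki kj) cuts (hangs_below1 _ _ kj ki).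
by apply/setP => l; apply/cubic_componentP/cubic_componentP => -[kl /eqv].
Qed.

(** In T, whatever hangs below i also hangs below its parent j. In T', the child subtree of i with
    labels above i is the one through j, so an l > j hanging below the pair {i, j} must be attached
    at j. *)
Lemma cubic_component_rotation_target : cubic_component T j = cubic_component T' j.
Proof.
apply/setP => l; apply/cubic_componentP/cubic_componentP => -[jl [c cj lc]].
  have il := ltn_trans ltij jl.
  split=> //; suff /rotation_hangs_below : hangs_below T [set i; j] l.
    case=> d [v [dv /set2P [] vE dK ld]]; rewrite {}vE in dv ld.
      move: dK; rewrite !inE negb_or => /andP [_ dj].
      by rewrite (two_children_sides dv ji ld (side_refl _ _ _) il ltij) eqxx in dj.
    by exists d.
  have [cE|ci] := eqVneq c i; last first.
    exists c, j; split=> //; rewrite !inE ?eqxx ?orbT // negb_or ci.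
    by apply: contraTneq (dedge_adj cj) => ->; rewrite adj_irr.
  rewrite {}cE in lc cj.
  (* When l is reached from j through i, it leaves i by a neighbour d other than j. This d is a
     child: the parent j already leads to a label above i, so a second parent cannot lead to l >
     i. *)
  have [|d di ld] := @toward _ T i l; first by rewrite neq_ltn il orbT.
  have dj : d != j.
    apply: contraTneq ld => ->; apply: side_disjoint lc; exact: dedge_adj.
  exists d, i; split=> //.
  - case/orP: di => // id.
    by rewrite (two_parents_sides id ij ld (side_refl _ _ _) il ltij) eqxx in dj.
  - by rewrite !inE eqxx.
  - rewrite !inE negb_or dj andbT.
    by apply: contraTneq di => ->; rewrite adj_irr.
have ci : c != i := child_not_parent ji cj.
split=> //; have /rotation_hangs_below : hangs_below T' [set i; j] l.
  exists c, j; split=> //; rewrite !inE ?eqxx ?orbT // negb_or ci.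
  by apply: contraTneq (dedge_adj cj) => ->; rewrite adj_irr.
case=> d [v [dv /set2P [] vE dK ld]]; rewrite {}vE in dv ld.
  move: dK; rewrite !inE negb_or => /andP [_ dj]; exists i => //.
  by apply: (fintype.subsetP (sub_side_next (dedge_adj dv) (dedge_adj ij) dj)).
by exists d.
Qed.

(** What hangs below {i, j} in T' hangs below i, as j is now its child. The new element is j itself:
    in T the child subtrees of i lie on the side of i in the cut ij. *)
Lemma cubic_component_rotation_source :
  cubic_component T i \proper cubic_component T' i.
Proof.
apply/properP; split.
  apply/fintype.subsetP => l /cubic_componentP [il [c ci lc]].
  apply/cubic_componentP; split=> //.
  have /rotation_hangs_below : hangs_below T [set i; j] l.
    exists c, i; split=> //; rewrite !inE ?eqxx // negb_or (child_not_parent ij ci) andbT.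
    by apply: contraTneq (dedge_adj ci) => ->; rewrite adj_irr.
  case=> d [v [dv /set2P [] vE dK ld]]; rewrite {}vE in dv ld.
    by exists d.
  move: dK; rewrite !inE negb_or => /andP [di _]; exists j => //.
  by apply: (fintype.subsetP (sub_side_next (dedge_adj dv) (dedge_adj ji) di)).
exists j; first by apply/cubic_componentP; split=> //; exists j => //; apply: side_refl.
apply/cubic_componentP => -[_ [c ci jc]].
have /fintype.subsetP/(_ _ jc) :=
  sub_side_next (dedge_adj ci) (dedge_adj ij) (child_not_parent ij ci).
by apply/negP/side_notin/dedge_adj.
Qed.

End OneRotation.

(** * From rotations to cubic vectors *)

Lemma increasing_rotation_cubic_vector T T' : increasing_rotation T T' ->
  exists i : 'I_n.-1,
    (forall k : 'I_n.-1, k != i -> tnth (cubic_vector T) k = tnth (cubic_vector T') k) /\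
    tnth (cubic_vector T) i < tnth (cubic_vector T') i.
Proof.
case=> i [j [ltij rot]].
(* Since i < j, the vertex i is not the last one and so indexes a coordinate. *)
have ltin : i < n.-1 by rewrite ltn_predRL; apply: leq_ltn_trans ltij (ltn_ord j).
exists (Ordinal ltin); split=> [k ki|]; rewrite !tnth_mktuple.
  congr #|pred_of_set _|; have [kj|kj] := eqVneq (widen_ord (leq_pred n) k) j.
    by rewrite kj; apply: cubic_component_rotation_target rot.
  by rewrite (cubic_component_rotation_other rot _ kj).
have -> : widen_ord (leq_pred n) (Ordinal ltin) = i by apply: val_inj.
exact/proper_card/(cubic_component_rotation_source ltij rot).
Qed.

Lemma rotation_lt_cubic_vector T T' :
  rotation_lt T T' -> (cubic_vector T < cubic_vector T')%O.
Proof.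
elim=> [{}T {}T' /increasing_rotation_cubic_vector [i [eq_ne lt_i]]|S1 S2 S3 _ + _].
  apply/ltxi_tuplePlt; exists i => // k ki.
  by apply: eq_ne; rewrite -val_eqE neq_ltn ki.
exact: lt_trans.
Qed.

(** A composite chain in the transitive closure passes through some S strictly between T and T',
    which a cover forbids. *)
Lemma rotation_cover_increasing T T' : rotation_cover T T' -> increasing_rotation T T'.
Proof.
by case=> -[//|S S' TS SS' [] //]; exists S.
Qed.

End Rotations.

Theorem theorem3p5 (R : realType) (n : nat)
    (delta : {ffun 'I_n -> decoration}) :
  (forall T T' : PT delta,
     rotation_lt T T' -> (cubic_vector T < cubic_vector T')%O) /\
  (forall e : 'rV[R]_(n.-1) * 'rV[R]_(n.-1),
     edges (cubical_realization R delta) e ->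
     exists i : 'I_(n.-1), has_direction e (delta_mx 0%R i)).
Proof.
split=> [|e [T [T' [/rotation_cover_increasing rot ->]]]].
  exact: rotation_lt_cubic_vector.
have [i [eq_ne lt_i]] := increasing_rotation_cubic_vector rot.
(* The scalar is the increase of the only coordinate that changes, hence nonzero. *)
exists i, ((tnth (cubic_vector T') i)%:R - (tnth (cubic_vector T) i)%:R)%R => /=.
  by rewrite subr_eq0 eqr_nat neq_ltn lt_i orbT.
apply/rowP => k; rewrite !mxE eqxx /=; have [->|ki] := eqVneq k i.
  by rewrite mulr1.
by rewrite eq_ne // subrr mulr0.
Qed.
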